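(* Let $G_1$ and $G_2$ be graphs. Suppose that the false-twin equivalence classes of $G_1$ are $G^1_1,\dots,G^1_r$ and those of $G_2$ are $G^2_1,\dots,G^2_s$, and that $|G^1_i|\ge 2$ for every $i$ and $|G^2_j|\ge 2$ for every $j$. Then $\mathrm{fix}(G_1*G_2)=|V(G_1)|\,|V(G_2)|-rs$.
   Context: All graphs are finite and simple. For graphs $G_1,G_2$, the co-normal product $G_1*G_2$ is the graph with vertex set $V(G_1)\times V(G_2)$ in which $(a,b)$ and $(c,d)$ are adjacent if and only if $a$ is adjacent to $c$ in $G_1$ or $b$ is adjacent to $d$ in $G_2$. The false-twin equivalence classes of a graph $G$ are the classes of the equivalence relation on $V(G)$ given by $u\equiv v$ iff $N(u)=N(v)$ (open neighborhoods). A set $F\subseteq V(G)$ is a fixing set of $G$ if the only automorphism of $G$ fixing every vertex of $F$ is the identity; $\mathrm{fix}(G)$ is the minimum cardinality of a fixing set. *)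

(* Defs.v *)
From mathcomp Require Import all_boot all_fingroup.
Set Implicit Arguments.
Unset Strict Implicit.
Unset Printing Implicit Defensive.

Record sgraph := SGraph {
  vertex :> finType;
  adj : rel vertex;
  adj_sym : symmetric adj;
  adj_irrefl : irreflexive adj }.

Definition conormal_rel (G1 G2 : sgraph) : rel (vertex G1 * vertex G2) :=
  fun u v => adj u.1 v.1 || adj u.2 v.2.

Lemma conormal_sym (G1 G2 : sgraph) : symmetric (@conormal_rel G1 G2).
Proof. by move=> u v; rewrite /conormal_rel adj_sym [adj u.2 _]adj_sym. Qed.

Lemma conormal_irrefl (G1 G2 : sgraph) : irreflexive (@conormal_rel G1 G2).
Proof. by move=> u; rewrite /conormal_rel !adj_irrefl. Qed.

Definition conormal (G1 G2 : sgraph) : sgraph :=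
  SGraph (@conormal_sym G1 G2) (@conormal_irrefl G1 G2).

Definition neighborhood (G : sgraph) (v : G) : {set G} := [set w | adj v w].

Definition false_twins (G : sgraph) : rel G :=
  fun u v => neighborhood u == neighborhood v.

Definition false_twin_classes (G : sgraph) : {set {set G}} :=
  equivalence_partition (@false_twins G) [set: G].

Definition automorphism (G : sgraph) (s : {perm G}) : bool :=
  [forall u, forall v, adj (s u) (s v) == adj u v].

Definition fixing_set (G : sgraph) (F : {set G}) : bool :=
  [forall s : {perm G},
    automorphism s ==> [forall v in F, s v == v] ==> (s == 1%g)].

Lemma fixing_setT (G : sgraph) : fixing_set [set: G].
Proof.
apply/forallP => s; apply/implyP => _; apply/implyP => /forall_inP fixs.
by apply/eqP/permP => v; rewrite perm1; apply/eqP/fixs; rewrite inE.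
Qed.

(* The seed [set: G] of the arg min is a fixing set by fixing_setT, so this is
   a genuine minimum. *)
Definition fixing_number (G : sgraph) : nat :=
  #|[arg min_(F < [set: G] | fixing_set F) #|F|]|.

(* Main.v *)
(** Transposing two false twins is an automorphism, so the complement of a fixing
    set meets every twin class at most once. Conversely, if no class is a singleton,
    the complement of a transversal is fixing: it meets every class, so an
    automorphism fixing it preserves every class, and hence also the one remaining
    vertex of each. Finally the twin classes of the co-normal product are the
    products of twin classes: the complement of the neighborhood of [(a, b)] is the
    rectangle [~: N(a) x ~: N(b)], whose sides contain [a] and [b], so are nonempty
    and thus determined by the rectangle. *)
Require Import Defs.
From mathcomp Require Import all_boot all_fingroup.
Set Implicit Arguments.
Unset Strict Implicit.
Unset Printing Implicit Defensive.

Section TwinClasses.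
Variable G : sgraph.
Local Notation N := (@neighborhood G).
Local Notation P := (false_twin_classes G).

Lemma false_twins_equiv : {in [set: G] & &, equivalence_rel (@false_twins G)}.
Proof. by move=> x y z _ _ _; split=> [|/eqP xy]; rewrite /false_twins ?eqxx ?xy. Qed.

Lemma false_twin_classes_partition : partition P [set: G].
Proof. exact: equivalence_partitionP false_twins_equiv. Qed.

Lemma pblock_false_twins (u v : G) : (v \in pblock P u) = (N u == N v).
Proof.
exact: (pblock_equivalence_partition false_twins_equiv (in_setT u) (in_setT v)).
Qed.

Lemma pblock_eq_false_twins (u v : G) : (pblock P u == pblock P v) = (N u == N v).
Proof.
have /and3P[/eqP covP tiP _] := false_twin_classes_partition.
by rewrite eq_pblock ?covP ?inE // pblock_false_twins.
Qed.

Lemma neighborhood_transversal_inj (T : {set G}) :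
  is_transversal T P [set: G] -> {in T &, injective N}.
Proof.
move=> trT u v uT vT /eqP; rewrite -pblock_eq_false_twins => /eqP.
exact: (pblock_inj trT).
Qed.

(** Each class is determined by the common neighborhood of its members. Counting neighborhoods
    instead of classes turns later counts into cardinalities of images. *)
Lemma card_false_twin_classes : #|P| = #|N @: [set: G]|.
Proof.
have partP := false_twin_classes_partition.
have trT := transversalP partP; set T := transversal _ _ in trT.
rewrite -(card_transversal trT) -(card_in_imset (f := N) (D := T)); last first.
  exact: neighborhood_transversal_inj.
apply/eqP; rewrite eqn_leq subset_leq_card ?imsetS ?subsetT //=.
apply/subset_leq_card/subsetP => _ /imsetP[v _ ->].
have vP : pblock P v \in P.
  by rewrite pblock_mem // (cover_partition partP) inE.
apply/imsetP; exists (transversal_repr v T (pblock P v)).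
  exact: (repr_mem_transversal trT).
apply/eqP; rewrite -pblock_false_twins.
exact: (repr_mem_pblock trT).
Qed.

(** Twins are non-adjacent, since [adj u v = adj v v], so the swap respects adjacency between the
    two vertices as well as towards all others. *)
Lemma automorphism_twin_tperm (u v : G) : N u = N v -> automorphism (tperm u v).
Proof.
move=> /setP Nuv; have adjl w : adj u w = adj v w by have := Nuv w; rewrite !inE.
have adjr w : adj w u = adj w v by rewrite adj_sym adjl adj_sym.
apply/forallP => x; apply/forallP => y; apply/eqP.
by do 2!case: tpermP => [->|->|_ _] //; rewrite ?adjl ?adjr ?adj_irrefl //;
   rewrite -?adjl -?adjr ?adj_irrefl.
Qed.

Lemma automorphism_neighborhood (s : {perm G}) (u v : G) :
  automorphism s -> N u = N v -> N (s u) = N (s v).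
Proof.
move=> /forallP auts /setP Nuv; apply/setP => w; rewrite !inE -(permKV s w).
have := Nuv (s^-1%g w); rewrite !inE.
by rewrite (eqP (forallP (auts u) _)) (eqP (forallP (auts v) _)).
Qed.

Lemma fixing_set_lower_bound (F : {set G}) : fixing_set F -> #|G| - #|P| <= #|F|.
Proof.
move=> /forallP fixF; rewrite leq_subLR -(cardsC F) addnC leq_add2r.
(* What remains is [#|~: F| <= #|P|], which follows once [N] is injective on [~: F]: swapping two
   twins outside [F] would fix [F] pointwise. *)
rewrite card_false_twin_classes -(card_in_imset (f := N) (D := ~: F)).
  by rewrite subset_leq_card // imsetS // subsetT.
move=> u v; rewrite !inE => uF vF Nuv.
have /implyP/(_ (automorphism_twin_tperm Nuv))/implyP := fixF (tperm u v).
have fixT : [forall w in F, tperm u v w == w].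
  by apply/forall_inP => w wF; rewrite tpermD //; apply: contraTneq wF => <-.
by move=> /(_ fixT)/eqP/permP/(_ u); rewrite tpermL perm1.
Qed.

Hypothesis twins : forall C : {set G}, C \in P -> 2 <= #|C|.

Lemma fixing_set_transversalC (T : {set G}) :
  is_transversal T P [set: G] -> fixing_set (~: T).
Proof.
move=> trT; have partP := false_twin_classes_partition.
have injT := neighborhood_transversal_inj trT.
apply/forallP => s; apply/implyP => auts; apply/implyP => /forall_inP fixs.
apply/eqP/permP => v; rewrite perm1.
case vT: (v \in T); last by apply/eqP/fixs; rewrite inE vT.
(* The class of [v] is not a singleton, and [T] meets it only in [v]; so a second member [w] lies
   outside [T] and is fixed by [s]. *)
have [w wv Nw] : exists2 w, w != v & N w = N v.
  have vP : pblock P v \in P by rewrite pblock_mem // (cover_partition partP) inE.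
  have /card_gt1P[x [y [xB yB xy]]] := twins vP.
  move: xB yB; rewrite !pblock_false_twins => /eqP xB /eqP yB.
  case: (eqVneq x v) => [xv|xv]; last by exists x.
  by exists y => //; rewrite eq_sym -xv.
have wT : w \notin T by apply: contraNN wv => wT; apply/eqP/injT.
have sw : s w = w by apply/eqP/fixs; rewrite inE.
have Nsv : N (s v) = N v.
  by rewrite -Nw -[in RHS]sw; apply: automorphism_neighborhood.
(* If [s v] is in [T], it is the representative of the class of [v], namely [v]. Otherwise [s] fixes
   [s v], and injectivity of [s] gives [s v = v]. *)
case svT: (s v \in T); first exact: injT.
by apply: (@perm_inj _ s); apply/eqP/fixs; rewrite inE svT.
Qed.

Lemma fixing_number_twins : fixing_number G = #|G| - #|P|.
Proof.
rewrite /fixing_number; case: arg_minnP => [|F fixF minF]; first exact: fixing_setT.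
have trT := transversalP false_twin_classes_partition.
apply/eqP; rewrite eqn_leq fixing_set_lower_bound // andbT.
(* The bound is rewritten as the size of the complement of a transversal, which is itself a fixing
   set. *)
rewrite -(card_transversal trT) -cardsT -cardsDS ?subsetT // setTD.
exact/minF/fixing_set_transversalC.
Qed.

End TwinClasses.

Section Conormal.
Variables G1 G2 : sgraph.

Lemma neighborhood_conormal (u : conormal G1 G2) :
  neighborhood u = ~: setX (~: neighborhood u.1) (~: neighborhood u.2).
Proof. by apply/setP => -[c d]; rewrite !inE negb_and !negbK. Qed.

Lemma neighborhood_conormal_eq (u v : conormal G1 G2) :
  (neighborhood u == neighborhood v) =
  (neighborhood u.1 == neighborhood v.1) && (neighborhood u.2 == neighborhood v.2).
Proof.
apply/eqP/andP => [|[/eqP e1 /eqP e2]]; last by rewrite !neighborhood_conormal e1 e2.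
rewrite !neighborhood_conormal => /setC_inj/setP Nuv.
have nbr c d : ~~ adj u.1 c && ~~ adj u.2 d = ~~ adj v.1 c && ~~ adj v.2 d.
  by have := Nuv (c, d); rewrite !inE.
(* As [u] is not its own neighbor, neither is it a neighbor of [v]. Hence setting one coordinate to
   that of [u] makes its factor true on both sides of [nbr] and isolates the other coordinate. *)
have := nbr u.1 u.2; rewrite !adj_irrefl => /esym/andP[/negPf vu1 /negPf vu2].
split; apply/eqP/setP => x; rewrite !inE; apply: negb_inj.
  by have := nbr x u.2; rewrite adj_irrefl vu2 !andbT.
by have := nbr u.1 x; rewrite adj_irrefl vu1.
Qed.

Lemma card_false_twin_classes_conormal :
  #|false_twin_classes (conormal G1 G2)| =
  #|false_twin_classes G1| * #|false_twin_classes G2|.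
Proof.
rewrite !card_false_twin_classes -cardsX.
set N1 := @neighborhood G1; set N2 := @neighborhood G2.
(* [f] rebuilds the neighborhood of a pair from those of its coordinates. Injectivity is claimed
   only on pairs of actual neighborhoods, whose complements are nonempty. *)
pose f (A : {set G1} * {set G2}) : {set conormal G1 G2} := ~: setX (~: A.1) (~: A.2).
rewrite -(card_in_imset (f := f)); last first.
  move=> [A1 A2] [B1 B2] /setXP[/imsetP[a1 _ ->] /imsetP[a2 _ ->]].
  move=> /setXP[/imsetP[b1 _ ->] /imsetP[b2 _ ->]] /eqP.
  have := neighborhood_conormal_eq (a1, a2) (b1, b2).
  by rewrite !neighborhood_conormal /f /N1 /N2 /= => -> /andP[/eqP-> /eqP->].
apply: eq_card => A; apply/imsetP/imsetP => [[[u v] _ ->]|[[A1 A2]]].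
  exists (N1 u, N2 v); last by rewrite neighborhood_conormal.
  by apply/setXP; split; apply: imset_f.
move=> /setXP[/imsetP[a1 _ ->] /imsetP[a2 _ ->]] ->.
by exists (a1, a2); rewrite ?inE // neighborhood_conormal.
Qed.

Lemma conormal_twin_classes_gt1 :
  (forall C, C \in false_twin_classes G1 -> 2 <= #|C|) ->
  forall C, C \in false_twin_classes (conormal G1 G2) -> 2 <= #|C|.
Proof.
move=> twins1 _ /imsetP[[a b] _ ->].
have aC : [set x in [set: G1] | false_twins a x] \in false_twin_classes G1.
  exact: imset_f.
have /card_gt1P[x [y [xC yC xy]]] := twins1 _ aC.
move: xC yC; rewrite !inE => xC yC.
(* Pairing two distinct twins of [a] with the same [b] gives two distinct twins of [(a, b)]. *)
apply/card_gt1P; exists (x, b), (y, b).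
split; last by apply: contraNneq xy => -[->].
  by rewrite !inE /false_twins neighborhood_conormal_eq /= (eqP xC) !eqxx.
by rewrite !inE /false_twins neighborhood_conormal_eq /= (eqP yC) !eqxx.
Qed.

End Conormal.

Theorem theorem3p11 (G1 G2 : sgraph)
  (twins1 : forall C : {set G1}, C \in false_twin_classes G1 -> 2 <= #|C|)
  (twins2 : forall C : {set G2}, C \in false_twin_classes G2 -> 2 <= #|C|) :
  fixing_number (conormal G1 G2) =
    #|G1| * #|G2| - #|false_twin_classes G1| * #|false_twin_classes G2|.
Proof.
rewrite fixing_number_twins; last exact: conormal_twin_classes_gt1.
by rewrite card_false_twin_classes_conormal card_prod.
Qed.
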